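(* Let $S$ be a Hausdorff semitopological semigroup and let $\Gamma$ be a set of pure $z$-filters on $\mathcal{LMC}(S)$ with the quotient topology. The following statements are equivalent: (a) There exists a continuous function $h:S\to\Gamma$ such that $\Gamma$ is a compact Hausdorff space, $h[S]$ is dense in $\Gamma$, and (i) for each $s\in S$, $s\in\bigcap h(s)$ (that is, $s$ belongs to every member of the $z$-filter $h(s)$), and (ii) for distinct $\mathcal{L}$ and $\mathcal{K}$ in $\Gamma$, there exists $B\in\mathcal{K}^\circ$ such that for each $A\in Z(\mathcal{LMC}(S))$, if $S^{\mathcal{LMC}}\setminus(\overline{B})^\circ\subseteq(\overline{A})^\circ$ then $A\in\mathcal{L}$. (b) $\Gamma$ is a quotient of $S^{\mathcal{LMC}}$. (c) $\Gamma$ is a quotient of $S^{\mathcal{LMC}}$, $\Gamma$ is a compact Hausdorff space, and $e[S]$ is dense in $\Gamma$.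
   Context: **The compactification.** $S$ is a semigroup with a Hausdorff topology in which all maps $\lambda_s(x)=sx$ and $r_s(x)=xs$ are continuous. $\mathcal{CB}(S)$ is the $C^*$-algebra of bounded continuous complex-valued functions on $S$, and $L_sf=f\circ\lambda_s$. For a multiplicative mean (character) $\mu$, put $(\mathbf{T}_\mu f)(s)=\mu(L_sf)$. $\mathcal{LMC}(S)$ is the set of $f\in\mathcal{CB}(S)$ with $\mathbf{T}_\mu f\in\mathcal{CB}(S)$ for every character $\mu$ of $\mathcal{CB}(S)$. It is a $C^*$-subalgebra containing the constants, and it is mapped into itself by $L_s$ and by $\mathbf{T}_\mu$ for every character $\mu$ of $\mathcal{LMC}(S)$. $S^{\mathcal{LMC}}$ is the (compact Hausdorff) space of characters of $\mathcal{LMC}(S)$ with the Gelfand topology and product $\mu\nu=\mu\circ\mathbf{T}_\nu$. $\varepsilon:S\to S^{\mathcal{LMC}}$ is the evaluation map, continuous with dense image. **Zero sets and $z$-filters.** $Z(\mathcal{LMC}(S))=\{f^{-1}(0):f\in\mathcal{LMC}(S)\}$. A $z$-filter on $\mathcal{LMC}(S)$ is a family $\mathcal{A}\subseteq Z(\mathcal{LMC}(S))$ with $S\in\mathcal{A}$, $\emptyset\notin\mathcal{A}$, closed under finite intersections and under supersets in $Z(\mathcal{LMC}(S))$. A $z$-ultrafilter is a maximal $z$-filter. For $A\subseteq S$, $\overline{A}$ denotes the closure of $\varepsilon(A)$ in $S^{\mathcal{LMC}}$, and for a subset $X$ of $S^{\mathcal{LMC}}$, $X^\circ$ is its interior. **Points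 as $z$-filters.** For every $z$-ultrafilter $p$, $\bigcap_{A\in p}\overline{A}$ is a single point $\mu_p$, and every point of $S^{\mathcal{LMC}}$ is of this form. Let $\widetilde{p}$ be the intersection of all $z$-ultrafilters $q$ with $\mu_q=\mu_p$. The map $\mu_p\mapsto\widetilde{p}$ is a bijection, by which $S^{\mathcal{LMC}}$ is identified with the set of all $z$-filters $\widetilde{p}$. For $s\in S$, $\widehat{s}=\{A\in Z(\mathcal{LMC}(S)):s\in A\}$ is a $z$-ultrafilter; it is the element of $S^{\mathcal{LMC}}$ corresponding to $\varepsilon(s)$. **Pure $z$-filters.** For a $z$-filter $\mathcal{A}$, $\overline{\mathcal{A}}=\{\widetilde{p}: p \text{ a } z\text{-ultrafilter},\ \mathcal{A}\subseteq p\}$, and $\mathcal{A}^\circ=\{A\in\mathcal{A}:\overline{\mathcal{A}}\subseteq(\overline{A})^\circ\}$. A $z$-filter $\mathcal{A}$ is pure if, for every $z$-ultrafilter $p$, $\mathcal{A}\subseteq p$ implies $\mathcal{A}\subseteq\widetilde{p}$. **Quotients.** A topological choice function for a set $\Gamma$ of pure $z$-filters is a function $f:\Gamma\to\bigcup\Gamma$ with $\overline{\mathcal{L}}\subseteq(\overline{f(\mathcal{L})})^\circ$ for each $\mathcal{L}\in\Gamma$. For $A\in Z(\mathcal{LMC}(S))$ let $A^*=\{\mathcal{L}\in\Gamma:\overline{\mathcal{L}}\cap\overline{A}\neq\emptyset\}$; the quotient topology on $\Gamma$ is generated by the sets $\Gamma\setminus A^*$. $\Gamma$ is a quotient of $S^{\mathcal{LMC}}$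 if it is a set of pure $z$-filters on $\mathcal{LMC}(S)$ with the quotient topology such that: (1) for every topological choice function $f$ for $\Gamma$ there is a finite $\mathcal{F}\subseteq\Gamma$ with $S^{\mathcal{LMC}}=\bigcup_{\mathcal{L}\in\mathcal{F}}(\overline{f(\mathcal{L})})^\circ$; (2) for distinct $\mathcal{L},\mathcal{K}\in\Gamma$ there exist $A\in\mathcal{L}^\circ$, $B\in\mathcal{K}^\circ$ such that for every $\mathcal{C}\in\Gamma$ and all $H,T\in Z(\mathcal{LMC}(S))$, either ($S^{\mathcal{LMC}}\setminus(\overline{A})^\circ\subseteq(\overline{H})^\circ$ implies $H\in\mathcal{C}$) or ($S^{\mathcal{LMC}}\setminus(\overline{B})^\circ\subseteq(\overline{T})^\circ$ implies $T\in\mathcal{C}$). In that case each $\widetilde{p}\in S^{\mathcal{LMC}}$ contains exactly one $\mathcal{L}\in\Gamma$; $\gamma:S^{\mathcal{LMC}}\to\Gamma$ is defined by $\gamma(\widetilde{p})\in\Gamma$, $\gamma(\widetilde{p})\subseteq\widetilde{p}$, and $e:S\to\Gamma$ by $e(s)=\gamma(\widehat{s})$. *)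

(* Defs.v *)
From HB Require Import structures.
From mathcomp Require Import all_boot all_order all_algebra.
From mathcomp Require Import complex.
From mathcomp Require Import all_classical all_reals all_analysis.

Set Implicit Arguments.
Unset Strict Implicit.
Unset Printing Implicit Defensive.
Import Order.TTheory GRing.Theory Num.Theory.
Import numFieldNormedType.Exports.

Local Open Scope classical_set_scope.
Local Open Scope complex_scope.
Local Open Scope ring_scope.

HB.structure Definition PreTopologicalSemigroup :=
  {S of Topological S & Semigroup S}.

(* Multiplication is only required to be separately continuous. *)
HB.mixin Record PreTopologicalSemigroup_isSemitopological S
    & PreTopologicalSemigroup S := {
  mull_continuous : forall s : S, continuous (fun t : S => (s * t)%g) ;
  mulr_continuous : forall s : S, continuous (fun t : S => (t * s)%g)
}.

#[short(type="semitopologicalSemigroupType")]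
HB.structure Definition SemitopologicalSemigroup :=
  {S of PreTopologicalSemigroup S
      & PreTopologicalSemigroup_isSemitopological S}.

Section Spectrum.
Context {R : realType} {S : Type}.
Implicit Types A : set (S -> R[i]^o).

(* Stated relationally so as to make sense for any set A of functions; it is
   used only when A is a subalgebra of S -> C containing the constants. *)
Record is_character A (mu : A -> R[i]^o) : Prop := IsCharacter {
  character1 : forall f : A, val f = 1 -> mu f = 1 ;
  characterD : forall f g h : A, val h = val f + val g -> mu h = mu f + mu g ;
  characterZ : forall (c : R[i]) (f g : A),
    val g = c *: val f -> mu g = c * mu f ;
  characterM : forall f g h : A, val h = val f * val g -> mu h = mu f * mu g
}.

(* As a subset of {ptws A -> C}, its type of elements gets the topology of
   pointwise convergence on A, i.e. the Gelfand topology. *)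
Definition spectrum A : set {ptws A -> R[i]^o} := [set mu | is_character mu].
Arguments spectrum : clear implicits.

Lemma evaluation_is_character A (s : S) :
  is_character (fun f : A => val f s).
Proof. by split=> [f|f g h|c f g|f g h] /= ->. Qed.

Definition evaluation A (s : S) : spectrum A :=
  SigSub (mem_set (evaluation_is_character A s)).

End Spectrum.
Arguments spectrum {R S} A _.

Section LMC.
Context (R : realType) (S : semitopologicalSemigroupType).

Definition CB : set (S -> R[i]^o) := [set f | continuous f /\ bounded_fun f].

Lemma CB_lmul (s : S) (f : S -> R[i]^o) :
  CB f -> CB (fun t => f (s * t)%g).
Proof.
move=> [fc [M [Mr fM]]]; split.
  move=> t; apply: (@continuous_comp _ _ _ (fun t : S => (s * t)%g) f).
    exact: mull_continuous.
  exact: fc.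
by exists M; split=> // x Mx t _; exact: fM.
Qed.

Definition ltranslate (s : S) (f : CB) : CB :=
  SigSub (mem_set (CB_lmul s (set_valP f))).

Definition Tmean (mu : spectrum CB) (f : CB) : S -> R[i]^o :=
  fun s => val mu (ltranslate s f).

Definition LMC : set (S -> R[i]^o) :=
  [set val f | f in [set f : CB | forall mu : spectrum CB, CB (Tmean mu f)]].

Definition SLMC : topologicalType := spectrum LMC.

Definition eps (s : S) : SLMC := evaluation LMC s.

End LMC.
Arguments LMC R S _ : clear implicits.
Arguments eps R {S} s.

Section ZFilters.
Context (R : realType) (S : semitopologicalSemigroupType).
Implicit Types (A : set S) (F p : set (set S)).

Definition zsets : set (set S) := [set f @^-1` [set 0] | f in LMC R S].

Record is_zfilter F : Prop := IsZFilter {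
  zfilter_zsets : F `<=` zsets ;
  zfilterT : F setT ;
  zfilter0 : ~ F set0 ;
  zfilterI : forall A B, F A -> F B -> F (A `&` B) ;
  zfilterS : forall A B, F A -> zsets B -> A `<=` B -> F B
}.

Definition is_zultrafilter p :=
  is_zfilter p /\ forall q, is_zfilter q -> p `<=` q -> q = p.

Definition bar A : set (SLMC R S) := closure (eps R @` A).

(* The points of SLMC are the characters.  For a z-ultrafilter p, zlim p is the
   singleton of the character mu_p with which the z-filter tilde p is
   identified. *)
Definition zlim p : set (SLMC R S) := \bigcap_(A in p) bar A.

Definition tilde p : set (set S) :=
  \bigcap_(q in [set q | is_zultrafilter q /\ zlim q = zlim p]) q.

(* { tilde p : p a z-ultrafilter, F `<=` p }, with tilde p read as mu_p. *)
Definition zbar F : set (SLMC R S) :=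
  \bigcup_(p in [set p | is_zultrafilter p /\ F `<=` p]) zlim p.

Definition zinterior F : set (set S) :=
  [set A | F A /\ zbar F `<=` (bar A)°].

Definition is_pure F :=
  is_zfilter F /\ forall p, is_zultrafilter p -> F `<=` p -> F `<=` tilde p.

End ZFilters.
Arguments zsets R {S} _.
Arguments is_zfilter R {S} F.
Arguments is_zultrafilter R {S} p.
Arguments bar R {S} A _.
Arguments zlim R {S} p _.
Arguments tilde R {S} p _.
Arguments zbar R {S} F _.
Arguments zinterior R {S} F _.
Arguments is_pure R {S} F.

Section Quotient.
Context (R : realType) (S : semitopologicalSemigroupType).
Context (Gamma : set (set (set S))).

(* The set Gamma as a type carrying the quotient topology. *)
Definition quotient_space : Type := let _ := R in Gamma.

HB.instance Definition _ := Choice.copy quotient_space (set_type Gamma).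

Definition star (A : set S) : set quotient_space :=
  [set L : Gamma | zbar R (val L) `&` bar R A !=set0].

HB.instance Definition _ := isSubBaseTopological.Build quotient_space
  (zsets R) (fun A => ~` star A).

Definition is_topological_choice (f : Gamma -> set S) :=
  (forall L : Gamma, (\bigcup_(K in Gamma) K) (f L)) /\
  (forall L : Gamma, zbar R (val L) `<=` (bar R (f L))°).

Definition is_quotient :=
  [/\ forall L, Gamma L -> is_pure R L,
      forall f, is_topological_choice f ->
        exists2 F : set Gamma, finite_set F &
          \bigcup_(L in F) (bar R (f L))° = setT
    & forall L K, Gamma L -> Gamma K -> L <> K ->
        exists A B, [/\ zinterior R L A, zinterior R K B &
          forall C, Gamma C -> forall H T, zsets R H -> zsets R T ->
            (~` (bar R A)° `<=` (bar R H)° -> C H) \/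
            (~` (bar R B)° `<=` (bar R T)° -> C T)]].

(* gamma (tilde p), i.e. gamma at the character mu_p, is the unique member of
   Gamma contained in tilde p. *)
Definition is_quotient_map (gamma : SLMC R S -> quotient_space) :=
  forall p mu, is_zultrafilter R p -> zlim R p = [set mu] ->
    forall L : Gamma, val L `<=` tilde R p <-> L = gamma mu.

End Quotient.
Arguments quotient_space R {S} Gamma.
Arguments star R {S Gamma} A _.
Arguments is_topological_choice R {S Gamma} f.
Arguments is_quotient R {S} Gamma.
Arguments is_quotient_map {R S Gamma} gamma.

(* Main.v *)
(* Write X for the character space of LMC(S).  Any character mu of an algebra
   of functions closed under composition with continuous maps C -> C is the
   limit of evaluations along a filter on S; so mu commutes with such
   compositions, LMC(S) inherits them from CB(S), X is compact Hausdorff with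
   eps(S) dense, and the closures of zero sets separate a closed set of X from
   the complement of a neighbourhood.
   For a z-filter L the set zbar L is the intersection of the closures of the
   members of L, and by compactness every zero set A with zbar L contained in
   the interior of bar A belongs to L.  Condition (2) of a quotient then says
   that, for distinct L and K, some neighbourhoods of zbar L and zbar K are such
   that no zbar C meets both, and (ii) that the zbar L are pairwise disjoint.
   Hence in (b) the sets zbar L partition X upper semicontinuously and Gamma is
   the corresponding compact Hausdorff quotient of X.  In (a), density and
   compactness make the zbar L cover X, the induced map X -> Gamma has a closed
   graph, so is continuous, and (2) is the Hausdorff property pulled back
   to X. *)
Require Import Defs.
From mathcomp Require Import all_boot all_order all_algebra.
From mathcomp Require Import finmap complex.
From mathcomp Require Import all_classical all_reals all_analysis.

Set Implicit Arguments.
Unset Strict Implicit.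
Unset Printing Implicit Defensive.
Import Order.TTheory GRing.Theory Num.Theory.
Import numFieldNormedType.Exports.

Local Open Scope classical_set_scope.
Local Open Scope complex_scope.
Local Open Scope ring_scope.

(** * Bounded complex functions *)

Lemma bounded_funP (R : realType) (T : Type) (f : T -> R[i]^o) :
  bounded_fun f <-> exists2 M : R[i], 0 < M & forall t, `|f t| <= M.
Proof.
split=> [/pinfty_ex_gt0[M M0 fM]|[M M0 fM]].
  by exists M => // t; exact: fM.
exists M; split; first exact: gtr0_real.
by move=> x Mx t _ /=; exact: le_trans (fM t) (ltW Mx).
Qed.

Lemma real_complex_continuous (R : realType) :
  continuous (fun x : R => (x%:C : R[i]^o)).
Proof.
move=> x; apply/(@cvgrPdist_lt _ R[i]^o) => e e0.
have eE : (complex.Re e)%:C = e by apply: RRe_real; exact: gtr0_real.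
have Re0 : 0 < complex.Re e by rewrite -ltcR eE.
near=> y.
rewrite -rmorphB /= normc_def /= expr0n addr0 sqrtr_sqr -eE ltcR.
near: y; exact: cvgr_dist_lt.
Unshelve. all: by end_near. Qed.

Lemma complex_continuous (R : realType) :
  continuous (fun z : R * R => (z.1 +i* z.2 : R[i]^o)).
Proof.
move=> z.
have -> : (fun z : R * R => (z.1 +i* z.2 : R[i]^o)) =
    (fun z => z.1%:C + 'i * z.2%:C).
  by apply/funext => -[x y]; rewrite -complexiE; simpc.
apply: (@cvgD _ R[i]^o).
  by apply: (@continuous_comp _ _ _ fst (fun x : R => (x%:C : R[i]^o)));
    [exact: cvg_fst|exact: real_complex_continuous].
apply: (@cvgM R[i]); first exact: cvg_cst.
by apply: (@continuous_comp _ _ _ snd (fun x : R => (x%:C : R[i]^o)));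
  [exact: cvg_snd|exact: real_complex_continuous].
Qed.

Lemma closed_disk (R : realType) (M : R[i]) :
  closed [set z : R[i]^o | `|z| <= M].
Proof.
move=> z zcl.
(* The order on [R[i]] is partial: a point of the disk forces [M] to be real, so that [|z|] can be
   compared with it. *)
have [w /= [wM _]] := zcl setT filterT.
have Mr : M \is Num.real by rewrite ger0_real // (le_trans _ wM).
rewrite /= real_leNgt ?normr_real//; apply/negP => Mz.
have zM0 : 0 < `|z| - M by rewrite subr_gt0.
have [v [/= vM]] := zcl _ (nbhsx_ballx z _ zM0).
rewrite -ball_normE /= => zv.
have := ler_distD v z 0; rewrite !subr0 => zvv.
have := le_lt_trans zvv (ltr_leD zv vM).
by rewrite subrK ltxx.
Qed.

Lemma compact_disk (R : realType) (M : R[i]) :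
  compact [set z : R[i]^o | `|z| <= M].
Proof.
pose r := complex.Re M; pose I := `[- r, r]%classic.
apply: (@subclosed_compact _ _ [set (z.1 +i* z.2 : R[i]^o) | z in I `*` I]).
- exact: closed_disk.
- apply: continuous_compact.
    by apply: continuous_subspaceT; exact: complex_continuous.
  by apply: compact_setX; exact: segment_compact.
- move=> z /= zM.
  have Mr : r%:C = M by apply: RRe_real; rewrite ger0_real // (le_trans _ zM).
  exists (complex.Re z, complex.Im z) => /=; last by case: z {zM}.
  split; rewrite /I /= in_itv /= -ler_norml -lecR Mr.
    exact: le_trans (normc_ge_Re _) zM.
  apply: le_trans zM; rewrite normc_def lecR -sqrtr_sqr ler_wsqrtr //.
  by rewrite lerDr sqr_ge0.
Qed.

Lemma conj_continuous (R : realType) :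
  continuous (fun z : R[i]^o => (Num.conj z : R[i]^o)).
Proof.
move=> x; apply/(@cvgrPdist_lt _ R[i]^o _ _ (nbhs_filter x)) => e e0; near=> y.
rewrite -rmorphB norm_conjC; near: y; exact: (@cvgr_dist_lt _ R[i]^o).
Unshelve. all: by end_near. Qed.

Lemma normc_continuous (R : realType) :
  continuous (fun z : R[i]^o => (`|z| : R[i]^o)).
Proof. by move=> x; exact: (@cvg_norm _ R[i]^o _ _ (nbhs_filter x)). Qed.

Lemma normc_sqr_continuous (R : realType) :
  continuous (fun z : R[i]^o => (`|z| * `|z| : R[i]^o)).
Proof.
move=> x; apply: (@cvgM R[i] _ _ (nbhs_filter x)); exact: normc_continuous.
Qed.

Lemma subc_continuous (R : realType) (c : R[i]) :
  continuous (fun z : R[i]^o => (z - c : R[i]^o)).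
Proof.
move=> x; apply: (@cvgB _ R[i]^o _ _ (nbhs_filter x)); first exact: cvg_id.
exact: cvg_cst.
Qed.

(* The conjugate of z over max(|z|^2, e^2), hence the inverse of z when
   e <= |z|. *)
Definition truncated_inv (R : realType) (e : R[i]) (z : R[i]^o) : R[i]^o :=
  Num.conj z / (2^-1 * (`|z| * `|z| + e * e + `| `|z| * `|z| - e * e |)).

Section TruncatedInverse.
Context (R : realType) (e : R[i]).
Hypothesis e0 : 0 < e.

Lemma truncated_inv_continuous : continuous (truncated_inv e).
Proof.
move=> z; apply: (@cvgM R[i] _ _ (nbhs_filter z)); first exact: conj_continuous.
apply: (@cvgV R[i] _ _ (nbhs_filter z)).
  rewrite gt_eqF// mulr_gt0// ?invr_gt0// ltr_pwDl// ltr_wpDl ?mulr_ge0//.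
  exact: mulr_gt0.
apply: (@cvgM R[i] _ _ (nbhs_filter z)); first exact: cvg_cst.
apply: (@cvgD _ R[i]^o _ _ (nbhs_filter z)).
  by apply: (@cvgD _ R[i]^o _ _ (nbhs_filter z));
    [exact: normc_sqr_continuous|exact: cvg_cst].
apply: (@cvg_norm _ R[i]^o _ _ (nbhs_filter z)).
by apply: (@cvgB _ R[i]^o _ _ (nbhs_filter z));
  [exact: normc_sqr_continuous|exact: cvg_cst].
Qed.

Lemma mul_truncated_inv (z : R[i]^o) : e <= `|z| -> z * truncated_inv e z = 1.
Proof.
move=> ez; rewrite /truncated_inv mulrA -normCK expr2.
rewrite [X in _ + _ + X]ger0_norm ?subr_ge0 ?ler_pM// ?(ltW e0)//.
have z0 : 0 < `|z| by exact: lt_le_trans ez.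
rewrite addrACA subrr addr0 -mulr2n -(mulr_natl (_ * _)) mulKf ?pnatr_eq0//.
by rewrite divff// mulf_neq0// gt_eqF.
Qed.

End TruncatedInverse.

Lemma sqr_add_small (K : numFieldType) (x y z e : K) :
  0 <= x -> 0 <= y -> 0 < z -> e <= z * z -> `|x * x + y * y| < e -> x < z.
Proof.
move=> x0 y0 z0 ez; rewrite ger0_norm ?addr_ge0 ?mulr_ge0// => xye.
rewrite -(ltr_pXn2r (n := 2))// ?nnegrE ?(ltW z0)// !expr2.
by apply: le_lt_trans (lt_le_trans xye ez); rewrite lerDl mulr_ge0.
Qed.

(** Makes the sets where a kernel function is small a filter base: |f|^2 + |g|^2 controls [f] and
    [g] at once, the bound [m] being the smaller of [e * e] and [d * d]. *)
Lemma normsq_small (R : realType) (e d : R[i]) : 0 < e -> 0 < d ->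
  exists2 m : R[i], 0 < m & forall x y : R[i]^o,
    `| `|x| * `|x| + `|y| * `|y| : R[i]^o| < m -> `|x| < e /\ `|y| < d.
Proof.
move=> e0 d0.
have [m [m0 me md]] : exists m : R[i], [/\ 0 < m, m <= e * e & m <= d * d].
  have ee0 : 0 < e * e by exact: mulr_gt0.
  have dd0 : 0 < d * d by exact: mulr_gt0.
  have [ed|/ltW de] := real_leP (gtr0_real ee0) (gtr0_real dd0).
    by exists (e * e).
  by exists (d * d).
exists m => // x y xym; split; first exact: sqr_add_small me xym.
by move: xym; rewrite addrC => xym; exact: sqr_add_small md xym.
Qed.

(** * Characters of function algebras *)

Section FunctionAlgebra.
Context (R : realType) (T : Type).
Implicit Types (B : set (T -> R[i]^o)).

(** Closure under composition with continuous maps stands in for norm completeness: it supplies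
    conjugates, squared moduli and truncated inverses. *)
Record function_algebra B : Prop := FunctionAlgebra {
  function_algebra_cst : forall c : R[i], B (cst c) ;
  function_algebraD : forall f g, B f -> B g -> B (f + g) ;
  function_algebraM : forall f g, B f -> B g -> B (f * g) ;
  function_algebra_comp : forall (F : R[i]^o -> R[i]^o) f,
    continuous F -> B f -> B (F \o f)
}.

Definition in_algebra B f (Bf : B f) : B := SigSub (mem_set Bf).

Context (B : set (T -> R[i]^o)) (algB : function_algebra B).
Context (mu : B -> R[i]^o) (mu_char : is_character mu).

Lemma character_cst (c : R[i]) (f : B) : val f = cst c -> mu f = c.
Proof.
move=> fc; pose u := in_algebra (function_algebra_cst algB 1).
have u1 : mu u = 1 by exact: (character1 mu_char).
rewrite (@characterZ _ _ _ _ mu_char c u f) ?u1 ?mulr1// fc.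
by apply/funext => t; exact: (esym (mulr1 c)).
Qed.

Lemma character_subc (f : B) : exists2 h : B,
  val h = (fun t => val f t - mu f) & mu h = 0.
Proof.
pose h := in_algebra
  (function_algebra_comp algB (@subc_continuous R (mu f)) (set_valP f)).
pose c := in_algebra (function_algebra_cst algB (- mu f)).
exists h => //; rewrite (@characterD _ _ _ _ mu_char f c h)//.
by rewrite (@character_cst (- mu f) c)// subrr.
Qed.

(** If |f| stayed at or above [e], the truncated inverse of [f] would be an inverse in [B], and [mu]
    could not vanish at [f]. *)
Lemma character_kernel_small (f : B) (e : R[i]) : mu f = 0 -> 0 < e ->
  exists t, `|val f t| < e.
Proof.
move=> f0 e0; apply: contrapT => /forallNP small.
pose k := in_algebra
  (function_algebra_comp algB (truncated_inv_continuous e0) (set_valP f)).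
pose u := in_algebra (function_algebra_cst algB 1).
have u1 : mu u = 1 by exact: (character1 mu_char).
have : mu u = mu f * mu k.
  apply: (characterM mu_char); apply/funext => t.
  apply: (esym (mul_truncated_inv e0 _)); have /negP := small t.
  by rewrite -real_leNgt ?normr_real// gtr0_real.
by rewrite u1 f0 mul0r => /eqP; rewrite oner_eq0.
Qed.

Definition normsq (f : B) : B := in_algebra
  (function_algebra_comp algB (@normc_sqr_continuous R) (set_valP f)).

Definition add_normsq (f g : B) : B := in_algebra
  (function_algebraD algB (set_valP (normsq f)) (set_valP (normsq g))).

Lemma character_kernel_normsq (f : B) : mu f = 0 -> mu (normsq f) = 0.
Proof.
move=> f0; pose k := in_algebra
  (function_algebra_comp algB (@conj_continuous R) (set_valP f)).
rewrite (@characterM _ _ _ _ mu_char f k (normsq f)) ?f0 ?mul0r//.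
by apply/funext => t; rewrite /= -expr2 normCK.
Qed.

Lemma character_kernel_add_normsq (f g : B) :
  mu f = 0 -> mu g = 0 -> mu (add_normsq f g) = 0.
Proof.
move=> f0 g0.
rewrite (@characterD _ _ _ _ mu_char (normsq f) (normsq g) (add_normsq f g))//.
by rewrite !character_kernel_normsq// addr0.
Qed.

(** Evaluations at points of [T] converge to [mu] along this filter, although [mu] itself need not
    be an evaluation. *)
Definition character_filter : set_system T :=
  filter_from [set he : B * R[i] | mu he.1 = 0 /\ 0 < he.2]
    (fun he => [set t | `|val he.1 t| < he.2]).

Global Instance character_filter_proper : ProperFilter character_filter.
Proof.
apply: filter_from_proper => [|[h e] [/= h0 e0]]; last first.
  exact: character_kernel_small.
apply: filter_from_filter.
  exists (in_algebra (function_algebra_cst algB 0), 1) => /=; split=> //.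
  exact: character_cst.
move=> [f e] [g d] [/= f0 e0] [/= g0 d0].
have [m m0 mP] := normsq_small e0 d0.
exists (add_normsq f g, m) => /=.
  by split=> //; exact: character_kernel_add_normsq.
by move=> t /= /mP.
Qed.

Lemma character_filter_cvg (f : B) :
  val f @ character_filter --> (mu f : R[i]^o).
Proof.
have [h hE h0] := character_subc f.
apply/(@cvgrPdist_lt _ R[i]^o) => e e0; exists (h, e) => //= t /=.
by rewrite hE distrC.
Qed.

(** Evaluations commute with [F]; [mu] is their limit along [character_filter], and limits of
    complex values are unique. *)
Lemma character_comp (F : R[i]^o -> R[i]^o) (f g : B) : continuous F ->
  val g = F \o val f -> mu g = F (mu f).
Proof.
move=> Fc gE; apply: (@cvg_unique _ (@norm_hausdorff _ R[i]^o)
  (val g @ character_filter)) => /=.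
  exact: character_filter_cvg.
rewrite gE; apply: (@cvg_comp _ _ _ (val f) F).
  exact: character_filter_cvg.
exact: Fc.
Qed.

Lemma character_add_normsq (f g : B) :
  mu (add_normsq f g) = `|mu f| * `|mu f| + `|mu g| * `|mu g|.
Proof.
rewrite (@characterD _ _ _ _ mu_char (normsq f) (normsq g) (add_normsq f g))//.
by congr (_ + _); exact: (character_comp (@normc_sqr_continuous R)).
Qed.

Lemma character_bound (f : B) (M : R[i]) :
  (forall t, `|val f t| <= M) -> `|mu f| <= M.
Proof.
move=> fM.
apply: (@closed_cvg _ _ character_filter _ (val f) _ (@closed_disk R M)).
  exact: nearW.
exact: character_filter_cvg.
Qed.

End FunctionAlgebra.

(** * The algebra LMC(S) *)

Section LMCAlgebra.
Context (R : realType) (S : semitopologicalSemigroupType).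

Lemma CB_function_algebra : function_algebra (@CB R S).
Proof.
split.
- move=> c; split; first by move=> s; exact: cvg_cst.
  apply/bounded_funP; exists (`|c| + 1); first by rewrite ltr_wpDl.
  by move=> t; rewrite lerDl.
- move=> f g [fc /bounded_funP[M M0 fM]] [gc /bounded_funP[N N0 gN]]; split.
    by move=> s; apply: (@cvgD _ R[i]^o); [exact: fc|exact: gc].
  apply/bounded_funP; exists (M + N); first exact: addr_gt0.
  by move=> t; apply: le_trans (ler_normD _ _) (lerD (fM t) (gN t)).
- move=> f g [fc /bounded_funP[M M0 fM]] [gc /bounded_funP[N N0 gN]]; split.
    by move=> s; apply: (@cvgM R[i]); [exact: fc|exact: gc].
  apply/bounded_funP; exists (M * N); first exact: mulr_gt0.
  by move=> t; rewrite normrM ler_pM.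
- move=> F f Fc [fc /bounded_funP[M M0 fM]]; split.
    by move=> s; apply: continuous_comp; [exact: fc|exact: Fc].
  (* The values of [f] lie in a compact disk. Near [z] every [N] above |F z| + 1 bounds [F], so by
     the covering property some [N] bounds it on the whole disk. *)
  have /compact_near_coveringP cov := @compact_disk R M.
  have [|N N0 FN] := pinfty_ex_gt0
    (cov _ _ (fun N z => `|F z| <= N) (@proper_pinfty_nbhs R[i]) _).
    move=> z _.
    exists ([set y | `|F z - F y| < 1], [set N | `|F z| + 1 < N]) => /=.
      split.
        exact: (@cvgr_dist_lt _ R[i]^o _ _ (nbhs_filter z) _ _ (Fc z)).
      by apply: nbhs_pinfty_gt; rewrite gtr0_real// ltr_wpDl.
    move=> [y N] /= [Fzy zN]; apply: le_trans (ltW zN).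
    have := ler_distD (F z) (F y) 0; rewrite !subr0 => /le_trans; apply.
    by rewrite addrC lerD2l distrC ltW.
  by apply/bounded_funP; exists N => // t; exact: FN (fM t).
Qed.

Lemma LMCP (f : S -> R[i]^o) : LMC R S f <->
  exists Cf : @CB R S f, forall mu : spectrum (@CB R S),
    @CB R S (Tmean mu (in_algebra Cf)).
Proof.
split=> [[g gT <-]|[Cf fT]]; last by exists (in_algebra Cf).
exists (set_valP g) => mu.
suff -> : in_algebra (set_valP g) = g by exact: gT.
exact: val_inj.
Qed.

(** A character of CB(S) respects constants, sums, products and continuous compositions, hence so
    does [Tmean mu]; each closure property then passes from CB(S) to LMC(S). *)
Lemma LMC_function_algebra : function_algebra (LMC R S).
Proof.
have algCB := CB_function_algebra.
split.
- move=> c; apply/LMCP; exists (function_algebra_cst algCB c) => mu.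
  rewrite (_ : Tmean _ _ = cst c); first exact: function_algebra_cst.
  by apply/funext => s; exact: (character_cst algCB (set_valP mu)).
- move=> f g /LMCP[Cf fT] /LMCP[Cg gT]; apply/LMCP.
  exists (function_algebraD algCB Cf Cg) => mu.
  rewrite (_ : Tmean _ _ = Tmean mu (in_algebra Cf) + Tmean mu (in_algebra Cg)).
    exact: function_algebraD.
  by apply/funext => s; exact: (characterD (set_valP mu)).
- move=> f g /LMCP[Cf fT] /LMCP[Cg gT]; apply/LMCP.
  exists (function_algebraM algCB Cf Cg) => mu.
  rewrite (_ : Tmean _ _ = Tmean mu (in_algebra Cf) * Tmean mu (in_algebra Cg)).
    exact: function_algebraM.
  by apply/funext => s; exact: (characterM (set_valP mu)).
- move=> F f Fc /LMCP[Cf fT]; apply/LMCP.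
  exists (function_algebra_comp algCB Fc Cf) => mu.
  rewrite (_ : Tmean _ _ = F \o Tmean mu (in_algebra Cf)).
    exact: function_algebra_comp.
  by apply/funext => s; exact: (character_comp algCB (set_valP mu)).
Qed.

Lemma LMC_continuous (f : S -> R[i]^o) : LMC R S f -> continuous f.
Proof. by move=> /LMCP[[]]. Qed.

Lemma LMC_bounded (f : S -> R[i]^o) : LMC R S f ->
  exists M : R[i], forall s, `|f s| <= M.
Proof. by move=> /LMCP[[_ /bounded_funP[M _ fM]] _]; exists M. Qed.

End LMCAlgebra.

(** * The character space of LMC(S) *)

(** Compactness for directed families, where no finite subcover has to be handled. If no single
    [f i] sufficed, the differences of [K] and [f i] would generate a proper filter with a cluster
    point in [K], which some [f j] surrounds. *)
Lemma compact_directed_cover (T : topologicalType) (K : set T)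
    (I : Type) (D : set I) (f : I -> set T) :
  compact K -> D !=set0 ->
  (forall i j, D i -> D j -> exists2 k, D k & f i `|` f j `<=` f k) ->
  (forall x, K x -> exists2 i, D i & nbhs x (f i)) ->
  exists2 i, D i & K `<=` f i.
Proof.
move=> cK D0 Ddir Kf; apply: contrapT => noi.
pose F := filter_from D (fun i => K `\` f i).
have FF : ProperFilter F.
  apply: filter_from_proper; last first.
    move=> i Di; apply: contrapT => /set0P/negP; rewrite negbK => /eqP.
    by rewrite setD_eq0 => Ki; apply: noi; exists i.
  apply: filter_from_filter => // i j Di Dj.
  have [k Dk fk] := Ddir _ _ Di Dj; exists k => // x [Kx fx].
  by split; split=> // fx'; apply: fx; apply: fk; [left|right].
have [i Di] := D0.
have [x [Kx xF]] := cK F FF (ex_intro2 _ _ i Di (@subDsetl _ K (f i))).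
have [j Dj fj] := Kf _ Kx.
have [y [[_ nfy] fy]] := xF (K `\` f j) (f j)
  (ex_intro2 _ _ j Dj (fun _ => id)) fj.
exact: nfy.
Qed.

Section Gelfand.
Context (R : realType) (S : semitopologicalSemigroupType).
Notation X := (SLMC R S).
Let algLMC := LMC_function_algebra R S.
Implicit Types (mu nu : X) (f : LMC R S).

Lemma SLMC_eval_continuous f : continuous (fun mu : X => (val mu f : R[i]^o)).
Proof.
move=> mu V fV.
have cvgmu : set_val @ mu --> (set_val mu : {ptws LMC R S -> R[i]^o}).
  exact: initial_continuous.
move: cvgmu => /(cvg_sup _ (set_val mu)) /(_ f [set g | V (g f)]); apply.
  by apply: fmap_filter; exact: nbhs_filter.
exact: (@initial_continuous _ _ (fun g : {ptws LMC R S -> R[i]^o} => g f)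
  (val mu) V fV).
Qed.

Lemma SLMC_cvg (F : set_system X) mu : Filter F ->
  (forall f, (fun nu : X => (val nu f : R[i]^o)) @ F --> (val mu f : R[i]^o)) ->
  F --> mu.
Proof.
move=> FF Fmu.
have : set_val @ F --> (set_val mu : {ptws LMC R S -> R[i]^o}).
  apply/cvg_sup => f V [_ [[U oU <-] Umu UV]].
  apply: filterS UV _; apply: (Fmu f); exact: open_nbhs_nbhs.
move=> cF V [_ [[U oU <-] Umu UV]].
by apply: filterS UV _; apply: cF; exact: open_nbhs_nbhs.
Qed.

Lemma SLMC_hausdorff : hausdorff_space X.
Proof.
move=> mu nu cl; apply: val_inj; apply/funext => f.
apply: (@norm_hausdorff _ R[i]^o) => U V Umu Vnu.
have [x [Ux Vx]] := cl _ _ (@SLMC_eval_continuous f mu U Umu)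
  (@SLMC_eval_continuous f nu V Vnu).
by exists (val x f).
Qed.

Lemma eps_cvg mu : eps R @ character_filter (val mu) --> mu.
Proof.
have FF := character_filter_proper algLMC (set_valP mu).
apply: SLMC_cvg => f; exact: (character_filter_cvg algLMC (set_valP mu)).
Qed.

Lemma eps_dense mu (U : set X) : nbhs mu U -> exists s, U (eps R s).
Proof.
have FF := character_filter_proper algLMC (set_valP mu).
move=> Umu; apply: (@filter_ex _ _ FF (fun s => U (eps R s))).
exact: eps_cvg Umu.
Qed.

Lemma eps_continuous : continuous (eps R : S -> X).
Proof.
move=> s; apply: SLMC_cvg => f; exact: LMC_continuous (set_valP f) s.
Qed.

(** Along an ultrafilter the values at each [f] stay in a compact disk, so they have a limit [m f];
    the identities that define a character survive the limit. *)
Lemma SLMC_compact : compact [set: X].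
Proof.
rewrite compact_ultra => G GU _.
have GF := @ultra_proper _ G GU.
have cvgG f : exists c : R[i]^o, (fun nu : X => (val nu f : R[i]^o)) @ G --> c.
  have [M fM] := LMC_bounded (set_valP f).
  have GM : G [set nu : X | `|val nu f| <= M].
    apply: nearW => nu; exact: (character_bound algLMC (set_valP nu) fM).
  have [c [_ cG]] := @compact_disk R M _
    (fmap_proper_filter (fun nu : X => (val nu f : R[i]^o)) GF) GM.
  exists c => V cV.
  (* A cluster point of an ultrafilter is a limit: the preimage of [V] or its complement lies in
     [G], and clustering at [c] rules out the complement. *)
  have [//|GV] := in_ultra_setVsetC
    ((fun nu : X => (val nu f : R[i]^o)) @^-1` V) GU.
  by have [y [nVy Vy]] := cG (~` V) V GV cV.
have [m mP] := choice cvgG.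
have m_char : is_character m.
  split=> [f f1|f g h hE|c f g gE|f g h hE].
  - apply: (@cvg_unique _ (@norm_hausdorff _ R[i]^o) _ _ _ _ (mP f)) => /=.
    apply: (@cvg_trans _ (cst (1 : R[i]^o) @ G)); last exact: cvg_cst.
    apply: near_eq_cvg; apply: nearW => nu.
    by rewrite (character1 (set_valP nu)).
  - apply: (@cvg_unique _ (@norm_hausdorff _ R[i]^o) _ _ _ _ (mP h)) => /=.
    apply: (@cvg_trans _ ((fun nu : X => (val nu f + val nu g : R[i]^o)) @ G)).
      apply: near_eq_cvg; apply: nearW => nu.
      by rewrite (characterD (set_valP nu) hE).
    by apply: (@cvgD _ R[i]^o); exact: mP.
  - apply: (@cvg_unique _ (@norm_hausdorff _ R[i]^o) _ _ _ _ (mP g)) => /=.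
    apply: (@cvg_trans _ ((fun nu : X => (c * val nu f : R[i]^o)) @ G)).
      apply: near_eq_cvg; apply: nearW => nu.
      by rewrite (characterZ (set_valP nu) gE).
    by apply: (@cvgM R[i]); [exact: cvg_cst|exact: mP].
  - apply: (@cvg_unique _ (@norm_hausdorff _ R[i]^o) _ _ _ _ (mP h)) => /=.
    apply: (@cvg_trans _ ((fun nu : X => (val nu f * val nu g : R[i]^o)) @ G)).
      apply: near_eq_cvg; apply: nearW => nu.
      by rewrite (characterM (set_valP nu) hE).
    by apply: (@cvgM R[i]); exact: mP.
exists (SigSub (mem_set m_char) : X); split=> //.
by apply: SLMC_cvg => f; exact: mP.
Qed.

End Gelfand.

(** * Zero sets *)

Section ZeroSets.
Context (R : realType) (S : semitopologicalSemigroupType).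
Notation X := (SLMC R S).
Let algLMC := LMC_function_algebra R S.
Implicit Types (mu nu : X) (f : LMC R S) (A B : set S) (U P : set X).

Lemma zsets_sublevel f (e : R[i]) : 0 <= e ->
  zsets R [set s | `|val f s| <= e].
Proof.
move=> e0.
(* Twice the positive part of |z| - e, which is zero exactly when |z| <= e. *)
pose F (z : R[i]^o) : R[i]^o := `|z| - e + `| `|z| - e |.
have Fc : continuous F.
  move=> z; apply: (@cvgD _ R[i]^o _ _ (nbhs_filter z)).
    by apply: (@cvgB _ R[i]^o _ _ (nbhs_filter z));
      [exact: normc_continuous|exact: cvg_cst].
  apply: (@cvg_norm _ R[i]^o _ _ (nbhs_filter z)).
  by apply: (@cvgB _ R[i]^o _ _ (nbhs_filter z));
    [exact: normc_continuous|exact: cvg_cst].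
exists (F \o val f); first exact: function_algebra_comp (set_valP f).
apply/seteqP; split=> s; rewrite /preimage /= /F.
  have : `|val f s| - e \is Num.real by rewrite realB ?normr_real ?ger0_real.
  rewrite -subr_le0; move=> /real_ltgt0P[]// fe; rewrite -mulr2n => /eqP.
  by rewrite mulrn_eq0 /= gt_eqF.
by rewrite -subr_le0 => fe; rewrite [ `|_ - _|]ler0_norm// subrr.
Qed.

Lemma zsetsI A B : zsets R A -> zsets R B -> zsets R (A `&` B).
Proof.
move=> [f Lf <-] [g Lg <-].
exists (val (add_normsq algLMC (in_algebra Lf) (in_algebra Lg))).
  exact: set_valP.
apply/seteqP; split=> s; rewrite /preimage /= /GRing.add /=.
  move=> /eqP; rewrite paddr_eq0 ?mulr_ge0// !mulf_eq0 !orbb !normr_eq0.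
  by move=> /andP[/eqP-> /eqP->].
by move=> [-> ->]; rewrite normr0 mulr0 addr0.
Qed.

Lemma zsetsU A B : zsets R A -> zsets R B -> zsets R (A `|` B).
Proof.
move=> [f Lf <-] [g Lg <-]; exists (f * g).
  exact: function_algebraM.
apply/seteqP; split=> s; rewrite /preimage /= /GRing.mul /=.
  by move=> /eqP; rewrite mulf_eq0 => /orP[]/eqP; [left|right].
by move=> [->|->]; rewrite ?mul0r ?mulr0.
Qed.

Lemma zsetsT : zsets R (@setT S).
Proof.
exists (cst 0); first exact: function_algebra_cst.
by apply/seteqP; split.
Qed.

Lemma zsets0 : zsets R (@set0 S).
Proof.
exists (cst 1); first exact: function_algebra_cst.
by apply/seteqP; split=> // s /= /eqP; rewrite oner_eq0.
Qed.

Lemma barS A B : A `<=` B -> bar R A `<=` bar R B.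
Proof. by move=> AB; apply: closureS; exact: image_subset. Qed.

Lemma closed_bar A : closed (bar R A).
Proof. exact: closed_closure. Qed.

Lemma bar0 : bar R (@set0 S) = set0.
Proof. by rewrite /bar image_set0 closure0. Qed.

Lemma barT : bar R (@setT S) = setT.
Proof.
apply/seteqP; split=> // mu _ U /eps_dense[s Us].
by exists (eps R s); split=> //; exists s.
Qed.

Lemma bar_closed A f (D : set R[i]^o) : closed D ->
  (forall s, A s -> D (val f s)) -> forall mu, bar R A mu -> D (val mu f).
Proof.
move=> cD AD mu muA; apply: cD => V muV.
have [nu [[s As <-] Vs]] := muA _ (@SLMC_eval_continuous R S f mu V muV).
by exists (val f s); split=> //; exact: AD.
Qed.

(** The function that cuts out [A] extends to the character space and vanishes on [bar R A], so
    taking the closure adds no point of [S] to a zero set. *)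
Lemma bar_eps A s : zsets R A -> bar R A (eps R s) -> A s.
Proof.
move=> [f Lf <-] /(@bar_closed _ (in_algebra Lf) [set 0]); apply => //.
exact: compact_closed (@norm_hausdorff _ R[i]^o) (@compact_set1 _ _).
Qed.

Lemma open_sub_bar U : open U -> U `<=` bar R (eps R @^-1` U).
Proof.
move=> oU mu Umu V Vmu.
have [s [Us Vs]] : exists s, (U `&` V) (eps R s).
  by apply: (@eps_dense _ _ mu); apply: filterI => //; exact: open_nbhs_nbhs.
by exists (eps R s); split=> //; exists s.
Qed.

(** An open set lies in the closure of the evaluations it contains, and by [bar_eps] an evaluation
    in both closures comes from a point of both zero sets. *)
Lemma interior_barI A B : zsets R A -> zsets R B ->
  (bar R A)° `&` (bar R B)° `<=` (bar R (A `&` B))°.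
Proof.
move=> zA zB; rewrite -interiorI; set U := (bar R A `&` bar R B)°.
have oU : open U by exact: open_interior.
rewrite -open_subsetE//.
apply: (subset_trans (open_sub_bar oU)); apply: barS => s Us.
by have [] := interior_subset Us; split; exact: bar_eps.
Qed.

(** One function suffices where the Gelfand topology allows finitely many: |f|^2 + |g|^2 merges two
    conditions, so these sets generate a filter, and it converges to [mu] at every [f]. *)
Lemma SLMC_nbhs_small mu U : nbhs mu U -> exists f (e : R[i]),
  [/\ val mu f = 0, 0 < e & [set nu : X | `|val nu f| < e] `<=` U].
Proof.
pose F := filter_from [set he : LMC R S * R[i] | val mu he.1 = 0 /\ 0 < he.2]
  (fun he => [set nu : X | `|val nu he.1| < he.2]).
have FF : Filter F.
  apply: filter_from_filter.
    exists (in_algebra (function_algebra_cst algLMC 0), 1) => /=; split=> //.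
    exact: (character_cst algLMC (set_valP mu)).
  move=> [f e] [g d] [/= f0 e0] [/= g0 d0].
  have [m m0 mP] := normsq_small e0 d0.
  exists (add_normsq algLMC f g, m) => /=.
    split=> //; exact: (character_kernel_add_normsq _ (set_valP mu)).
  by move=> nu /=; rewrite (character_add_normsq algLMC (set_valP nu)) => /mP.
have Fmu : F --> mu.
  apply: SLMC_cvg => f; have [h hE h0] := character_subc algLMC (set_valP mu) f.
  apply/(@cvgrPdist_lt _ R[i]^o) => e e0; exists (h, e) => //= nu /=.
  suff -> : val nu h = val nu f - val mu f by rewrite distrC.
  exact: (character_comp algLMC (set_valP nu) (@subc_continuous R (val mu f))).
by move=> /Fmu[[f e] [/= f0 e0] fU]; exists f, e.
Qed.

Lemma zset_nbhs mu U : nbhs mu U ->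
  exists A, [/\ zsets R A, (bar R A)° mu & bar R A `<=` U].
Proof.
move=> /SLMC_nbhs_small[f [e [f0 e0 fU]]].
have e20 : 0 < e / 2 by rewrite divr_gt0.
(* Halving leaves room: on the closure only the non-strict bound [e / 2] survives, which is still
   below [e]. *)
exists [set s | `|val f s| <= e / 2]; split.
- exact: zsets_sublevel (ltW e20).
- have := @SLMC_eval_continuous R S f mu _
    (@nbhsx_ballx _ R[i]^o (val mu f) (e / 2) e20).
  rewrite nbhs_simpl nbhsE => -[W [oW Wmu] WV].
  have : W `<=` bar R [set s | `|val f s| <= e / 2]; last first.
    by rewrite open_subsetE// => /(_ _ Wmu).
  apply: (subset_trans (open_sub_bar oW)); apply: barS => s /WV.
  by rewrite /= f0 -ball_normE /= sub0r normrN => /ltW.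
- move=> nu /(bar_closed (@closed_disk R (e / 2))) nuf.
  apply: fU; apply: (@le_lt_trans _ _ (e / 2)); first exact: nuf.
  by rewrite ltr_pdivrMr// ltr_pMr// ltr1n.
Qed.

(** Takes the place of Urysohn's lemma. Zero sets with closure in [U] are directed under union and
    give neighbourhoods of each point of the compact set [P]. *)
Lemma zset_separation P U : closed P -> open U -> P `<=` U ->
  exists A, [/\ zsets R A, P `<=` (bar R A)° & bar R A `<=` U].
Proof.
move=> cP oU PU.
have [||mu Pmu|A [zA AU] PA] := @compact_directed_cover X P (set S)
  [set A | zsets R A /\ bar R A `<=` U] (fun A => (bar R A)°)
  (subclosed_compact cP (@SLMC_compact R S) (@subsetT _ P)).
- by exists set0; split; [exact: zsets0|rewrite bar0].
- move=> A B [zA AU] [zB BU]; exists (A `|` B).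
    split; first exact: zsetsU.
    by rewrite /bar image_setU closureU; move=> mu [/AU|/BU].
  by move=> mu [] /=; apply: interiorS; apply: barS => s; [left|right].
- have [|A [zA muA AU]] := @zset_nbhs mu U.
    by apply: open_nbhs_nbhs; split=> //; exact: PU.
  exists A => //; apply: open_nbhs_nbhs; split=> //; exact: open_interior.
by exists A.
Qed.

End ZeroSets.

(** * z-filters and their limits *)

Section ZFilterLimits.
Context (R : realType) (S : semitopologicalSemigroupType).
Notation X := (SLMC R S).
Implicit Types (mu nu : X) (A B C : set S) (F N p q : set (set S)).

Lemma zultrafilter_extension F : is_zfilter R F ->
  exists2 p, is_zultrafilter R p & F `<=` p.
Proof.
move=> zF.
(* Ranging over the [G] whose union with [F] is a z-filter makes the empty chain harmless: it yields
   [F] itself. *)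
have [|G [zG Gmax]] := @Zorn_bigcup (set S) [set G | is_zfilter R (F `|` G)].
  move=> D DP Dtot; rewrite /mkset.
  have [->|/set0P[G0 DG0]] := eqVneq D set0; first by rewrite bigcup_set0 setU0.
  split.
  - move=> A [/(zfilter_zsets zF)//|[G /DP zG GA]].
    by apply: (zfilter_zsets zG); right.
  - by left; exact: zfilterT zF.
  - move=> [/(zfilter0 zF)//|[G /DP zG G0']].
    by apply: (zfilter0 zG); right.
  - have key G A B : D G -> (F `|` G) A -> (F `|` G) B ->
        (F `|` \bigcup_(G in D) G) (A `&` B).
      move=> DG GA GB; have [|GAB] := zfilterI (DP _ DG) GA GB; first by left.
      by right; exists G.
    move=> A B [FA|[G DG GA]] [FB|[H DH HB]].
    + by left; exact: zfilterI zF _ _ FA FB.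
    + by apply: key DH _ _; [left|right].
    + by apply: key DG _ _; [right|left].
    + have [GH|HG] := Dtot _ _ DG DH.
        by apply: key DH _ _; right => //; exact: GH.
      by apply: key DG _ _; right => //; exact: HG.
  - move=> A B [FA|[G DG GA]] zB AB.
      by left; exact: zfilterS zF _ _ FA zB AB.
    have [|GB] := zfilterS (DP _ DG) (or_intror GA) zB AB; first by left.
    by right; exists G.
exists (F `|` G); last by move=> A; left.
split=> // q zq FGq; apply: contrapT => qFG.
have zFq : is_zfilter R (F `|` q).
  by rewrite (_ : F `|` q = q)//; apply/setUidr => A FA; apply: FGq; left.
apply: (Gmax q) zFq.
split=> [A GA|qG]; first by apply: FGq; right.
by apply: qFG; apply/seteqP; split=> // A qA; right; exact: qG.
Qed.

Lemma zultrafilter_join F N : is_zfilter R F -> is_zfilter R N ->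
  (forall A B, F A -> N B -> A `&` B !=set0) ->
  exists p, [/\ is_zultrafilter R p, F `<=` p & N `<=` p].
Proof.
move=> zF zN FN.
pose G := [set C | zsets R C /\
  exists AB : set S * set S, [/\ F AB.1, N AB.2 & AB.1 `&` AB.2 `<=` C]].
have zG : is_zfilter R G.
  split.
  - by move=> C [].
  - split; first exact: zsetsT.
    by exists (setT, setT); split=> //; [exact: zfilterT zF|exact: zfilterT zN].
  - by move=> [_ [[A B] [/= FA NB AB0]]]; have [s /AB0] := FN _ _ FA NB.
  - move=> C D [zC [[A B] [/= FA NB ABC]]] [zD [[A' B'] [/= FA' NB' ABD]]].
    split; first exact: zsetsI.
    exists (A `&` A', B `&` B'); split=> /=.
    + exact: zfilterI zF _ _ FA FA'.
    + exact: zfilterI zN _ _ NB NB'.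
    + by move=> s [[As A's] [Bs B's]]; split; [exact: ABC|exact: ABD].
  - move=> C D [zC [AB [FA NB ABC]]] zD CD; split=> //; exists AB; split=> //.
    exact: subset_trans CD.
have [p pu Gp] := zultrafilter_extension zG; exists p; split=> //.
- move=> A FA; apply: Gp; split; first exact: zfilter_zsets zF _ FA.
  by exists (A, setT); split=> [//||s []//]; exact: zfilterT zN.
- move=> A NA; apply: Gp; split; first exact: zfilter_zsets zN _ NA.
  by exists (setT, A); split=> [|//|s []//]; exact: zfilterT zF.
Qed.

(** Joining [p] with the zero supersets of [A] gives a z-ultrafilter containing [p], which equals
    [p] by maximality. *)
Lemma zultrafilter_mem p A : is_zultrafilter R p -> zsets R A ->
  (forall B, p B -> B `&` A !=set0) -> p A.
Proof.
move=> pu zA pA.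
have zN : is_zfilter R [set C | zsets R C /\ A `<=` C].
  split.
  - by move=> C [].
  - by split=> //; exact: zsetsT.
  - move=> [_ A0]; have [s [_ /A0]] := pA _ (zfilterT pu.1); exact.
  - move=> C D [zC subAC] [zD AD]; split; first exact: zsetsI.
    by rewrite subsetI.
  - by move=> C D [zC subAC] zD CD; split=> //; exact: subset_trans CD.
have [|q [qu pq Nq]] := zultrafilter_join pu.1 zN.
  move=> B C pB [_ subAC]; have [s [Bs As]] := pA _ pB.
  by exists s; split=> //; exact: subAC.
by rewrite -(pu.2 _ qu.1 pq); apply: Nq; split.
Qed.

(** Attaches a z-filter to a point: a z-ultrafilter that contains it can have no limit but [mu]. *)
Lemma nbhs_zfilter mu : is_zfilter R [set A | zsets R A /\ (bar R A)° mu].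
Proof.
split.
- by move=> A [].
- split; first exact: zsetsT.
  by rewrite barT; exact: filterT.
- by move=> [_]; rewrite bar0 interior0.
- move=> A B [zA muA] [zB muB]; split; first exact: zsetsI.
  exact: interior_barI.
- move=> A B [zA muA] zB AB; split=> //.
  by apply: interiorS muA; exact: barS.
Qed.

Lemma bar_interior_meets mu A B : bar R A mu -> zsets R B -> (bar R B)° mu ->
  A `&` B !=set0.
Proof.
move=> muA zB muB; have [nu [[s As <-] Bs]] := muA _ muB.
by exists s; split=> //; exact: bar_eps Bs.
Qed.

Lemma zfilter_bar_nonempty F A : is_zfilter R F -> F A -> bar R A !=set0.
Proof.
move=> zF FA; have [A0|/set0P[s As]] := eqVneq A set0.
  by move: FA; rewrite A0 => /(zfilter0 zF).
exists (eps R s); apply: subset_closure; by exists s.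
Qed.

Lemma zfilter_cap_bar F : is_zfilter R F -> (\bigcap_(A in F) bar R A) !=set0.
Proof.
move=> zF; apply: contrapT => F0.
have [|||A FA] := @compact_directed_cover X setT (set S) F
    (fun A => ~` bar R A) (@SLMC_compact R S).
- by exists setT; exact: zfilterT zF.
- move=> A B FA FB; exists (A `&` B); first exact: zfilterI zF _ _ FA FB.
  by move=> mu [nA|nB]; [move=> /(barS (@subIsetl _ _ _))
                        |move=> /(barS (@subIsetr _ _ _))].
- move=> mu _; apply: contrapT => nmu; apply: F0; exists mu => A FA.
  apply: contrapT => nA; apply: nmu; exists A => //; apply: open_nbhs_nbhs.
  by split=> //; apply: closed_openC; exact: closed_bar.
have [mu FA'] := zfilter_bar_nonempty zF FA.
by move=> /(_ mu Logic.I).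
Qed.

Lemma zlim_nbhs p mu A : is_zultrafilter R p -> zlim R p mu -> zsets R A ->
  (bar R A)° mu -> p A.
Proof.
move=> pu pmu zA muA; apply: zultrafilter_mem => // B pB.
exact: bar_interior_meets (pmu _ pB) zA muA.
Qed.

Lemma zlim_eq p mu : is_zultrafilter R p -> zlim R p mu -> zlim R p = [set mu].
Proof.
move=> pu pmu; apply/seteqP; split=> [nu pnu|_ ->//].
apply: (@SLMC_hausdorff R S) => U V Unu Vmu.
have [A [zA muA AV]] := zset_nbhs Vmu.
exists nu; split; first exact: nbhs_singleton.
by apply: AV; apply: pnu; exact: zlim_nbhs muA.
Qed.

(** For [mu] in all the closures, [F] and the zero-set neighbourhoods of [mu] lie in a common
    z-ultrafilter, whose limit must be [mu]. *)
Lemma zbarE F : is_zfilter R F -> zbar R F = \bigcap_(A in F) bar R A.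
Proof.
move=> zF; apply/seteqP; split=> [mu [p [pu Fp] pmu] A FA|mu Fmu].
  by apply: pmu; exact: Fp.
have [|p [pu Fp Np]] := zultrafilter_join zF (nbhs_zfilter mu).
  by move=> A B FA [zB muB]; exact: bar_interior_meets (Fmu _ FA) zB muB.
exists p => //; have [nu pnu] := zfilter_cap_bar pu.1.
suff -> : mu = nu by [].
apply: (@SLMC_hausdorff R S) => U V Umu Vnu.
have [A [zA muA AU]] := zset_nbhs Umu.
exists nu; split; last exact: nbhs_singleton.
by apply: AU; apply: pnu; exact: Np.
Qed.

Lemma zbar_nonempty F : is_zfilter R F -> zbar R F !=set0.
Proof. by move=> zF; rewrite zbarE//; exact: zfilter_cap_bar. Qed.

Lemma closed_zbar F : is_zfilter R F -> closed (zbar R F).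
Proof.
by move=> zF; rewrite zbarE//; apply: closed_bigI => A _; exact: closed_bar.
Qed.

Lemma zbar_sub_bar F A : is_zfilter R F -> F A -> zbar R F `<=` bar R A.
Proof. by move=> zF FA; rewrite zbarE// => mu; apply. Qed.

(** The closures of members of [F] shrink to [zbar R F], so by compactness one of them lies in the
    interior of [bar R A]; [bar_eps] turns this into an inclusion in [A]. *)
Lemma zfilter_interior F A : is_zfilter R F -> zsets R A ->
  zbar R F `<=` (bar R A)° -> F A.
Proof.
move=> zF zA FA.
have [|||B FB BA] := @compact_directed_cover X setT (set S) F
    (fun B => ~` bar R B `|` (bar R A)°) (@SLMC_compact R S).
- by exists setT; exact: zfilterT zF.
- move=> B C FB FC; exists (B `&` C); first exact: zfilterI zF _ _ FB FC.
  move=> mu [[nB|]|[nC|]]; try by right.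
    by left => /(barS (@subIsetl _ _ _)).
  by left => /(barS (@subIsetr _ _ _)).
- move=> mu _; have [Fmu|] := pselect ((\bigcap_(A in F) bar R A) mu).
    exists setT; first exact: zfilterT zF.
    apply: open_nbhs_nbhs; rewrite barT setCT set0U; split.
      exact: open_interior.
    by apply: FA; rewrite zbarE.
  move=> /existsNP[B] /not_implyP[FB nB]; exists B => //.
  apply: open_nbhs_nbhs; split; last by left.
  apply: openU; last exact: open_interior.
  by apply: closed_openC; exact: closed_bar.
apply: (zfilterS zF FB zA) => s Bs; apply: bar_eps zA _.
have [//|nB|/interior_subset//] := BA (eps R s).
by exfalso; apply: nB; apply: subset_closure; exists s.
Qed.

(** [tilde] depends on a z-ultrafilter only through its limit, so purity allows the witness [q] of
    [zbar R F mu] to be traded for [p]. *)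
Lemma pure_tildeP F p mu : is_pure R F -> is_zultrafilter R p ->
  zlim R p = [set mu] -> F `<=` tilde R p <-> zbar R F mu.
Proof.
move=> [zF pF] pu pmu; split=> [Fp|[q [qu Fq] qmu]].
  exists p; last by rewrite pmu.
  by split=> // A /Fp; apply; split.
have -> : tilde R p = tilde R q by rewrite /tilde pmu (zlim_eq qu qmu).
exact: pF.
Qed.

(* Both halves of condition (2) in the definition of a quotient, and condition
   (ii) of the theorem, are disjointness statements. *)
Lemma zfilter_compl_interiorP F A : is_zfilter R F ->
  (forall H, zsets R H -> ~` (bar R A)° `<=` (bar R H)° -> F H) <->
  zbar R F `&` (bar R A)° = set0.
Proof.
move=> zF; split=> [FA|FA H zH AH]; last first.
  apply: zfilter_interior => //; apply: subset_trans AH => mu Fmu Amu.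
  by have : (zbar R F `&` (bar R A)°) mu by []; rewrite FA.
rewrite -subset0 => mu [Fmu Amu].
have [||| H [zH AH HU]] := @zset_separation R S (~` (bar R A)°) (~` [set mu]).
- by apply: open_closedC; exact: open_interior.
- apply: closed_openC; apply: compact_closed; first exact: SLMC_hausdorff.
  exact: compact_set1.
- by move=> nu nA E; apply: nA; rewrite E.
by have /HU := zbar_sub_bar zF (FA _ zH AH) Fmu; apply.
Qed.

End ZFilterLimits.

(** * The quotient topology *)

Section QuotientSpace.
Context (R : realType) (S : semitopologicalSemigroupType).
Context (Gamma : set (set (set S))).
Hypothesis pureGamma : forall L, Gamma L -> is_pure R L.
Notation X := (SLMC R S).
Notation Q := (quotient_space R Gamma).
Implicit Types (mu nu : X) (A B C : set S) (L K : Gamma).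

Let zfG L : is_zfilter R (val L).
Proof. by have [] := pureGamma (set_valP L). Qed.

Lemma open_setC_star A : zsets R A -> open (~` star R A : set Q).
Proof.
move=> zA; exists [set ~` star R A]; last by rewrite bigcup_set1.
move=> _ ->; exists [fset A]%fset; first by move=> B /fset1P ->; exact: mem_set.
by rewrite set_fset1 bigcap_set1.
Qed.

Lemma quotient_space_cvg (F : set_system Q) (L : Q) : Filter F ->
  (forall A, zsets R A -> (~` star R A) L -> F (~` star R A)) -> F --> L.
Proof.
move=> FF FL V /=; rewrite (@nbhsE Q).
move=> [_ [[B sB <-] [C BC CL] sUBV]].
rewrite nbhs_filterE; apply: filterS sUBV _; apply: (@filterS _ _ _ C).
  by move=> K CK; exists C.
have [D sD IDeC] := sB _ BC; rewrite -IDeC; apply: filter_bigI => A DA.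
apply: FL; first by have /sD := DA; rewrite inE.
by move: CL; rewrite -IDeC => /(_ _ DA).
Qed.

Lemma is_quotient_mapP (gamma : X -> Q) :
  (forall mu L, zbar R (val L) mu <-> L = gamma mu) -> is_quotient_map gamma.
Proof.
move=> gP p mu pu pmu L; rewrite -gP.
exact: pure_tildeP (pureGamma (set_valP L)) pu pmu.
Qed.

Definition zbar_separated := forall L K, L <> K ->
  exists A B, [/\ zinterior R (val L) A, zinterior R (val K) B &
    forall C : Gamma, zbar R (val C) `&` (bar R A)° = set0 \/
                      zbar R (val C) `&` (bar R B)° = set0].

Lemma quotient_separationP :
  (forall L K : set (set S), Gamma L -> Gamma K -> L <> K ->
    exists A B, [/\ zinterior R L A, zinterior R K B &
      forall C : set (set S), Gamma C -> forall H T, zsets R H -> zsets R T ->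
        (~` (bar R A)° `<=` (bar R H)° -> C H) \/
        (~` (bar R B)° `<=` (bar R T)° -> C T)]) <-> zbar_separated.
Proof.
split=> [sep L K LK|sep L K GL GK LK].
  have [||//|A [B [LA KB ABP]]] := sep (val L) (val K); [exact: set_valP..| |].
    by move=> E; apply: LK; exact: val_inj.
  exists A, B; split=> // C.
  rewrite -!(zfilter_compl_interiorP _ (zfG C)).
  (* As [H] and [T] vary independently, a disjunction valid for all pairs makes one side hold
     universally. *)
  apply: contrapT => /not_orP[/existsNP[H /not_implyP[zH nH]]].
  move=> /existsNP[T /not_implyP[zT nT]].
  by have [] := ABP _ (set_valP C) _ _ zH zT.
have [|A [B [LA KB ABP]]] := sep (SigSub (mem_set GL)) (SigSub (mem_set GK)).
  by move=> [].
exists A, B; split=> // C GC H T zH zT.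
have := ABP (SigSub (mem_set GC)).
rewrite -!(zfilter_compl_interiorP _ (zfG _)).
by move=> [CH|CT]; [left; exact: CH|right; exact: CT].
Qed.

Lemma zbar_separated_disjoint L K mu : zbar_separated ->
  zbar R (val L) mu -> zbar R (val K) mu -> L = K.
Proof.
move=> sep Lmu Kmu; apply: contrapT => /sep[A [B [[_ LA] [_ KB] ABP]]].
have [AL|BL] := ABP L.
  suff : set0 mu by [].
  by rewrite -AL; split=> //; exact: LA.
suff : set0 mu by [].
by rewrite -BL; split=> //; exact: KB.
Qed.

(** If [mu] were in no [zbar], each [zbar] would have a zero-set neighbourhood whose closure misses
    [mu]. These form a topological choice function that never covers [mu]. *)
Lemma choice_cover_total :
  (forall f : Gamma -> set S, is_topological_choice R f ->
     exists2 F : set Gamma, finite_set F &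
       \bigcup_(L in F) (bar R (f L))° = setT) ->
  forall mu, exists L, zbar R (val L) mu.
Proof.
move=> cov mu; apply: contrapT => /forallNP nmu.
have [L|f fP] := @choice _ _ (fun L A => [/\ zsets R A,
    zbar R (val L) `<=` (bar R A)° & bar R A `<=` ~` [set mu]]) _.
  apply: zset_separation; first exact: closed_zbar.
    apply: closed_openC; apply: compact_closed; first exact: SLMC_hausdorff.
    exact: compact_set1.
  by move=> nu Lnu E; apply: (nmu L); rewrite -E.
have [|F _ FT] := cov f.
  split=> [L|L]; last by have [] := fP L.
  exists (val L); first exact: set_valP.
  by have [zf Lf _] := fP L; exact: zfilter_interior.
have [L _] : (\bigcup_(L in F) (bar R (f L))°) mu by rewrite FT.
by have [_ _ fmu] := fP L; move=> /interior_subset/fmu; exact.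
Qed.

Lemma separated_hausdorff : zbar_separated -> hausdorff_space Q.
Proof.
move=> sep L K; apply: contraPP => /sep[A [B [[LA LAi] [KB KBi] ABP]]] cl.
(* Upper semicontinuity: a neighbourhood of [zbar] of [M] contains [zbar] of every [C] in some
   subbasic neighbourhood of [M]. Here [bar R H] covers the outside of that neighbourhood and misses
   [zbar] of [M]. *)
have sepH (M : Gamma) D : zbar R (val M) `<=` (bar R D)° ->
    exists H, [/\ zsets R H, (~` star R H) (M : Q) &
      forall C : Gamma, (~` star R H) (C : Q) ->
        zbar R (val C) `<=` (bar R D)°].
  move=> MD.
  have [|||H [zH DH HM]] :=
      @zset_separation R S (~` (bar R D)°) (~` zbar R (val M)).
  - by apply: open_closedC; exact: open_interior.
  - by apply: closed_openC; exact: closed_zbar.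
  - exact: subsetC.
  exists H; split=> // [[x [Mx Hx]]|C nC x Cx]; first exact: HM Hx Mx.
  by apply: contrapT => /DH/interior_subset Hx; apply: nC; exists x.
have [H [zH LH HP]] := sepH _ _ LAi.
have [T [zT KT TP]] := sepH _ _ KBi.
have [|| C [CH CT]] := cl (~` star R H) (~` star R T).
- by apply: open_nbhs_nbhs; split=> //; exact: open_setC_star.
- by apply: open_nbhs_nbhs; split=> //; exact: open_setC_star.
have [x Cx] := zbar_nonempty (zfG C).
have [C0|C0] := ABP C; suff : set0 x by []; rewrite -C0; split=> //.
- exact: HP Cx.
- exact: TP Cx.
Qed.

(** * The map from the character space onto the quotient *)

Section QuotientMap.
Context (gamma : X -> Q).
Hypothesis gammaP : forall mu L, zbar R (val L) mu <-> L = gamma mu.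

Lemma zbar_gamma mu : zbar R (val (gamma mu : Gamma)) mu.
Proof. by apply/gammaP. Qed.

Lemma gamma_surjective (L : Q) : exists mu, gamma mu = L.
Proof.
have [mu Lmu] := zbar_nonempty (zfG L).
by exists mu; apply/esym/gammaP.
Qed.

(** Continuity is tested on the complement of [star R A]. Compactness of [bar R A] merges the
    separations of [mu] from its points into one neighbourhood of [mu], none of whose points shares
    a [zbar] with [bar R A]. *)
Lemma separated_quotient_map_continuous : zbar_separated -> continuous gamma.
Proof.
move=> sep mu.
have FF : Filter (gamma @ mu) by apply: fmap_filter; exact: nbhs_filter.
apply: quotient_space_cvg => A zA nA.
pose L : Gamma := gamma mu.
pose D := [set UV : set X * set X | [/\ open UV.1, UV.1 mu &
  forall C : Gamma, zbar R (val C) `&` UV.1 !=set0 ->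
    zbar R (val C) `&` UV.2 = set0]].
have [|||[U V] [/= oU Umu UVP] AV] :=
    @compact_directed_cover X (bar R A) _ D snd
  (subclosed_compact (@closed_bar R S A) (@SLMC_compact R S) (@subsetT _ _)).
- by exists (setT, set0); split=> //= [|C _]; [exact: openT|rewrite setI0].
- move=> [U V] [U' V'] [/= oU Umu UV] [/= oU' U'mu UV'].
  exists (U `&` U', V `|` V'); last by [].
  split=> /=; [exact: openI|by []|move=> C [nu [Cnu [Unu U'nu]]]].
  by rewrite setIUr UV ?UV' ?setU0//; exists nu.
- move=> nu Anu; have LK : L <> gamma nu.
    move=> E; apply: nA; exists nu; split=> //.
    by move: (zbar_gamma nu); rewrite -E.
  have [B [C [[_ LB] [_ KC] BCP]]] := sep _ _ LK.
  exists ((bar R B)°, (bar R C)°).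
    split=> /=; [exact: open_interior|exact: LB (zbar_gamma mu)|].
    by move=> K [x KBx]; have [K0|//] := BCP K; move: KBx; rewrite K0.
  apply: open_nbhs_nbhs; split; first exact: open_interior.
  exact: KC (zbar_gamma nu).
apply: (@filterS _ _ _ U); last exact: open_nbhs_nbhs.
move=> nu Unu [x [nux Ax]].
suff : set0 x by [].
rewrite -(UVP (gamma nu)); first by split=> //; exact: AV.
by exists nu; split=> //; exact: zbar_gamma.
Qed.

Lemma quotient_map_compact : continuous gamma -> compact [set: Q].
Proof.
move=> gc; rewrite (_ : setT = gamma @` setT).
  apply: continuous_compact; last exact: SLMC_compact.
  exact: continuous_subspaceT.
by apply/seteqP; split=> // L _; have [mu <-] := gamma_surjective L; exists mu.
Qed.

Lemma quotient_map_dense : continuous gamma ->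
  dense (range (fun s => gamma (eps R s))).
Proof.
move=> gc O [L OL] oO; have [mu muL] := gamma_surjective L.
have [s Os] : exists s, (gamma @^-1` O) (eps R s).
  apply: (@eps_dense _ _ mu); apply: gc; rewrite muL.
  exact: open_nbhs_nbhs.
by exists (gamma (eps R s)); split=> //; exists s.
Qed.

End QuotientMap.

Lemma separated_quotient_map : zbar_separated ->
  (forall mu, exists L, zbar R (val L) mu) ->
  exists gamma : X -> Q, forall mu L, zbar R (val L) mu <-> L = gamma mu.
Proof.
move=> sep /choice[gamma gP]; exists gamma => mu L; split=> [Lmu|->//].
exact: zbar_separated_disjoint sep Lmu (gP mu).
Qed.

Lemma total_choice_cover (f : Gamma -> set S) :
  (forall mu, exists L, zbar R (val L) mu) -> is_topological_choice R f ->
  exists2 F : set Gamma, finite_set F & \bigcup_(L in F) (bar R (f L))° = setT.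
Proof.
move=> tot [_ fP].
have [|||F finF FT] := @compact_directed_cover X setT _ (@finite_set Gamma)
    (fun F => \bigcup_(L in F) (bar R (f L))°) (@SLMC_compact R S).
- by exists set0; exact: finite_set0.
- move=> F G finF finG; exists (F `|` G); first by rewrite finite_setU.
  by rewrite bigcup_setU.
- move=> mu _; have [L Lmu] := tot mu; exists [set L]; first exact: finite_set1.
  rewrite bigcup_set1; apply: open_nbhs_nbhs; split; first exact: open_interior.
  exact: fP.
by exists F => //; apply/seteqP.
Qed.

(* The relation { (mu, L) | mu in zbar L } is closed in X * Q. *)
Lemma cluster_zbar (T : Type) (F : set_system T) (g : T -> X) (k : T -> Q)
    mu (L : Q) : Filter F -> g @ F --> mu ->
  (forall t, zbar R (val (k t : Gamma)) (g t)) -> cluster (k @ F) L ->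
  zbar R (val (L : Gamma)) mu.
Proof.
move=> FF gmu gk kL; apply: contrapT => nLmu.
have [|A [zA muA AL]] := @zset_nbhs R S mu (~` zbar R (val (L : Gamma))).
  by apply: open_nbhs_nbhs; split=> //; apply: closed_openC; exact: closed_zbar.
have [||K [[t tA <-] nA]] := kL (k @` [set t | (bar R A)° (g t)]) (~` star R A).
- have Amu : nbhs mu (bar R A)°.
    by apply: open_nbhs_nbhs; split=> //; exact: open_interior.
  have : F [set t | (bar R A)° (g t)] by exact: (gmu _ Amu).
  by move/(filterS _); apply => t tA; exists t.
- apply: open_nbhs_nbhs; split; first exact: open_setC_star.
  by move=> [x [Lx Ax]]; exact: AL Ax Lx.
by apply: nA; exists (g t); split=> //; exact: interior_subset.
Qed.

(** Evaluations converge to [mu] along its character filter; a cluster point of [h] along that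
    filter works because membership in [zbar] is a closed relation. *)
Lemma dense_selection_total (h : S -> Q) : compact [set: Q] ->
  (forall s, zbar R (val (h s : Gamma)) (eps R s)) ->
  forall mu, exists L, zbar R (val L) mu.
Proof.
move=> cQ hP mu.
have FF := character_filter_proper (LMC_function_algebra R S) (set_valP mu).
have [|L [_ hL]] := cQ (h @ character_filter (val mu)) _.
  exact: filterT.
exists L; apply: cluster_zbar hL => //; exact: eps_cvg.
Qed.

(** Closed graph argument: [gamma mu] is the only cluster point of [gamma] at [mu], hence the limit
    in a compact Hausdorff space. *)
Lemma quotient_map_continuous (gamma : X -> Q) :
  compact [set: Q] -> hausdorff_space Q ->
  (forall mu L, zbar R (val L) mu <-> L = gamma mu) -> continuous gamma.
Proof.
move=> cQ hQ gammaP mu.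
have FF : ProperFilter (gamma @ mu).
  by apply: fmap_proper_filter; exact: nbhs_pfilter.
have clE L : cluster (gamma @ mu) L -> L = gamma mu.
  move=> cl; apply/gammaP; apply: (@cluster_zbar _ _ id gamma) cl => //.
  by move=> nu; apply/gammaP.
apply: (compact_cluster_set1 hQ cQ) => //; try exact: filterT.
apply/seteqP; split=> [L /clE//|_ ->].
by have [|L [_ cl]] := cQ _ FF; [exact: filterT|rewrite -(clE L cl)].
Qed.

(** The sets [zbar] are the fibres of the continuous map [gamma]. Zero-set neighbourhoods of two
    fibres, taken inside preimages of disjoint open sets, cannot both meet a third fibre. *)
Lemma hausdorff_zbar_separated (gamma : X -> Q) :
  compact [set: Q] -> hausdorff_space Q ->
  (forall mu L, zbar R (val L) mu <-> L = gamma mu) -> zbar_separated.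
Proof.
move=> cQ hQ gammaP L K /eqP LK.
have gc := quotient_map_continuous cQ hQ gammaP.
have := hQ; rewrite open_hausdorff => /(_ _ _ LK)[[U V] /= [UL VK] [oU oV UV0]].
have sep (M : Gamma) (W : set Q) : open W -> W M -> exists A,
    zinterior R (val M) A /\ bar R A `<=` gamma @^-1` W.
  move=> oW WM.
  have [|||A [zA MA AW]] :=
      @zset_separation R S (zbar R (val M)) (gamma @^-1` W).
  - exact: closed_zbar.
  - by move/continuousP : gc; apply.
  - by move=> mu /gammaP E; rewrite /preimage /= -E.
  by exists A; split=> //; split=> //; exact: zfilter_interior.
have [A [LA AU]] := sep L U oU (set_mem UL).
have [B [KB BV]] := sep K V oV (set_mem VK).
exists A, B; split=> // C; apply: contrapT => /not_orP[].
move=> /eqP/set0P[x [/gammaP Cx Ax]] /eqP/set0P[y [/gammaP Cy By]].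
have : (U `&` V) C.
  split; first by rewrite Cx; exact: AU (interior_subset Ax).
  by rewrite Cy; exact: BV (interior_subset By).
by rewrite (eqP UV0).
Qed.

End QuotientSpace.

(** * Equivalence of the intrinsic description with the two forms of being a quotient *)

Theorem theorem3p16 (R : realType) (S : semitopologicalSemigroupType)
    (hausS : hausdorff_space S) (Gamma : set (set (set S)))
    (pureGamma : forall L, Gamma L -> is_pure R L) :
  ((exists h : S -> quotient_space R Gamma,
      [/\ continuous h,
          compact [set: quotient_space R Gamma],
          hausdorff_space (quotient_space R Gamma),
          dense (range h)
        & (forall s, (\bigcap_(A in val (h s)) A) s) /\
          (forall L K, Gamma L -> Gamma K -> L <> K ->
             exists2 B, zinterior R K B &
               forall A, zsets R A -> ~` (bar R B)° `<=` (bar R A)° -> L A)])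
   <-> is_quotient R Gamma) /\
  (is_quotient R Gamma <->
    [/\ is_quotient R Gamma,
        compact [set: quotient_space R Gamma],
        hausdorff_space (quotient_space R Gamma)
      & exists2 gamma : SLMC R S -> quotient_space R Gamma,
          is_quotient_map gamma & dense (range (fun s => gamma (eps R s)))]).
Proof.
have zfG (L : Gamma) : is_zfilter R (val L).
  by have [] := pureGamma _ (set_valP L).
have quotientP : is_quotient R Gamma ->
    zbar_separated R Gamma /\ exists gamma : SLMC R S -> quotient_space R Gamma,
      forall mu (L : Gamma), zbar R (val L) mu <-> L = gamma mu.
  move=> [_ cov /(quotient_separationP pureGamma) sep]; split=> //.
  apply: separated_quotient_map => //; exact: choice_cover_total.
split; last first.
  split=> [quoG|[]//]; have [sep [gamma gammaP]] := quotientP quoG.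
  have gc := separated_quotient_map_continuous gammaP sep.
  split=> //.
  - exact: quotient_map_compact gammaP gc.
  - exact: separated_hausdorff.
  - exists gamma; first exact: is_quotient_mapP.
    exact: quotient_map_dense gammaP gc.
split=> [[h [_ cQ hQ _ [hi hii]]]|quoG].
  (* Condition (i) places each evaluation in the [zbar] that [h] selects. *)
  have hP s : zbar R (val (h s : Gamma)) (eps R s).
    rewrite zbarE// => A hA; apply: subset_closure; exists s => //.
    exact: hi.
  have tot := dense_selection_total pureGamma cQ hP.
  (* By (ii), [zbar] of [L] misses an open set that contains [zbar] of [K]. *)
  have disj (L K : Gamma) mu :
      zbar R (val L) mu -> zbar R (val K) mu -> L = K.
    move=> Lmu Kmu; apply: contrapT => LK.
    have [|B [_ KB]] := hii _ _ (set_valP L) (set_valP K).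
      by move=> E; apply: LK; exact: val_inj.
    move=> /(zfilter_compl_interiorP _ (zfG L)) L0.
    have : set0 mu by rewrite -L0; split=> //; exact: KB.
    by [].
  have /choice[gamma gP] := tot.
  have gammaP mu (L : Gamma) : zbar R (val L) mu <-> L = gamma mu.
    by split=> [Lmu|->//]; exact: disj Lmu (gP mu).
  split=> //; first by move=> f; exact: total_choice_cover.
  apply/(quotient_separationP pureGamma).
  exact: hausdorff_zbar_separated gammaP.
have [sep [gamma gammaP]] := quotientP quoG.
have gc := separated_quotient_map_continuous gammaP sep.
(* The map required in (a) is the canonical map [e] of the quotient. *)
exists (fun s => gamma (eps R s)); split.
- move=> s; apply: continuous_comp; [exact: eps_continuous|exact: gc].
- exact: quotient_map_compact gammaP gc.
- exact: separated_hausdorff.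
- exact: quotient_map_dense gammaP gc.
split=> [s A sA|L K GL GK LK].
  apply: (@bar_eps R); first exact: zfilter_zsets (zfG _) _ sA.
  by apply: zbar_sub_bar sA _ _ => //; apply/gammaP.
have [|A [B [[_ LA] KB ABP]]] :=
    sep (SigSub (mem_set GL)) (SigSub (mem_set GK)).
  by move=> [].
exists B => //; apply/zfilter_compl_interiorP; first exact: (pureGamma _ GL).1.
(* Separation applied to [L] itself: its nonempty [zbar] lies in the interior of [bar R A], so it
   must miss the interior of [bar R B]. *)
have [L0|//] := ABP (SigSub (mem_set GL)).
have [mu Lmu] := zbar_nonempty (pureGamma _ GL).1.
have : set0 mu by rewrite -L0; split=> //; exact: LA.
by [].
Qed.
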